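(* Let $K$ be a field, let $S=K[x_1,\ldots,x_n]$, and let $1\leq q\leq n$. Let $I_q\subset S$ be the ideal generated by all square-free monomials of degree $q$ in $x_1,\ldots,x_n$. Then for every $i\geq 0$, $$\beta_i(I_q)=\beta_{i,q+i}(I_q)=\binom{n}{q+i}\binom{q+i-1}{i}.$$
   Context: $S$ carries the standard grading. For a graded ideal $I\subset S$ with minimal graded free resolution $0\to F_p\to\cdots\to F_1\to F_0\to I\to 0$ over $S$, write $F_i=\bigoplus_j S(-j)^{\beta_{i,j}(I)}$; the $\beta_{i,j}(I)$ are the graded Betti numbers and $\beta_i(I)=\sum_j\beta_{i,j}(I)$ is the rank of $F_i$. Note that the resolution is of the ideal $I$ itself, not of $S/I$. Binomial coefficients $\binom{a}{b}$ with $0\le a<b$ are $0$. *)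

(* Defs.v *)
From mathcomp Require Import all_boot all_order all_algebra.
From mathcomp Require Import mpoly.

Set Implicit Arguments.
Unset Strict Implicit.
Unset Printing Implicit Defensive.

Import GRing.Theory.
Local Open Scope ring_scope.

Definition generated_ideal (R : comNzRingType) (G : R -> Prop) (f : R) : Prop :=
  exists2 s : seq (R * R),
    (forall u, u \in s -> G u.2) & f = \sum_(u <- s) u.1 * u.2.

Definition squarefree_monomial (K : fieldType) (n q : nat)
    (f : {mpoly K[n]}) : Prop :=
  exists m : 'X_{1..n},
    [/\ forall i, (m i <= 1)%N, mdeg m = q & f = 'X_[m]].

Definition squarefree_ideal (K : fieldType) (n q : nat) :
    {mpoly K[n]} -> Prop :=
  generated_ideal (@squarefree_monomial K n q).

(* Degrees are integers because a twist S(-j) makes sense for every integer j;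
   the zero polynomial is homogeneous of every degree, and it is the only one
   of negative degree. *)
Definition homogeneous_of_degree (K : fieldType) (n : nat) (d : int)
    (f : {mpoly K[n]}) : Prop :=
  forall m, m \in msupp f -> (mdeg m)%:Z = d.

(* The data of a sequence ... -> F_1 -> F_0 -> S of free S-modules with chosen
   bases, where F_i = S(-d_{i,1}) + ... + S(-d_{i,r_i}) has rank r_i = fr_rank i
   and its k-th basis vector has degree d_{i,k} = fr_deg k.  Elements of F_i are
   row vectors, and maps act by right multiplication: F_{i+1} -> F_i is
   v |-> v *m fr_diff i, and F_0 -> S is v |-> v *m fr_aug. *)
Record free_sequence (K : fieldType) (n : nat) := FreeSequence {
  fr_rank : nat -> nat;
  fr_deg : forall i, 'I_(fr_rank i) -> int;
  fr_aug : 'M[{mpoly K[n]}]_(fr_rank 0, 1);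
  fr_diff : forall i, 'M[{mpoly K[n]}]_(fr_rank i.+1, fr_rank i)
}.

Section Resolution.

Variables (K : fieldType) (n : nat).
Implicit Types (F : free_sequence K n) (I : {mpoly K[n]} -> Prop).

Definition finite_length F : Prop :=
  exists p, forall i, (p < i)%N -> fr_rank F i = 0%N.

(* Every map preserves degrees. *)
Definition graded F : Prop :=
  (forall k, homogeneous_of_degree (fr_deg k) (fr_aug F k 0)) /\
  (forall i k l,
     homogeneous_of_degree (fr_deg k - fr_deg l) (fr_diff F i k l)).

(* Exactness of ... -> F_1 -> F_0 -> I -> 0. *)
Definition resolves I F : Prop :=
  [/\ forall f, I f <-> exists v : 'rV_(fr_rank F 0), f%:M = v *m fr_aug F,
      forall v : 'rV_(fr_rank F 0),
        v *m fr_aug F = 0 <-> exists w, v = w *m fr_diff F 0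
    & forall i (v : 'rV_(fr_rank F i.+1)),
        v *m fr_diff F i = 0 <-> exists w, v = w *m fr_diff F i.+1].

(* F_{i+1} is mapped into (x_1, ..., x_n) F_i, that is, the entries of the
   matrices have zero constant term. *)
Definition minimal F : Prop :=
  forall i k l, (fr_diff F i k l)@_0%MM = 0.

Definition minimal_graded_free_resolution I F : Prop :=
  [/\ finite_length F, graded F, resolves I F & minimal F].

Definition graded_betti F (i : nat) (j : int) : nat :=
  #|[set k : 'I_(fr_rank F i) | fr_deg k == j]|.

Definition betti F (i : nat) : nat := fr_rank F i.

End Resolution.

(* Main.v *)
Require Import Defs.
From Stdlib Require Import IndefiniteDescription.
From mathcomp Require Import all_boot all_order all_algebra.
From mathcomp Require Import mpoly.
From mathcomp Require Import ring zify.

Set Implicit Arguments.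
Unset Strict Implicit.
Unset Printing Implicit Defensive.

(** Write J(k,q) for the ideal of the polynomials all of whose monomials
    involve at least q of the first k variables (vars_ideal).  It is generated
    by the squarefree monomials of degree q in these variables, so that
    J(n,q) = I_q (squarefree_idealE), and in this form membership is a
    condition on single monomials.

    Existence.  Let x be the variable of index k, counted from 0.  Sorting
    monomials by whether they need x gives J(k+1,q+1) = J(k,q+1) + x J(k,q)
    (vars_idealS), and x f lies in J(k,q+1) only if f does (vars_ideal_mulX).
    Hence
      0 -> J(k,q+1)(-1) -> J(k,q+1) + J(k,q)(-1) -> J(k+1,q+1) -> 0,
    with maps c |-> (x c, - c) and (a, b) |-> a + x b, is exact.  If F and G
    are linear resolutions of J(k,q+1) and J(k,q), a graded lift F -> G of the
    inclusion yields a mapping cone F_i + G_i(-1) + F_(i-1)(-1) that resolves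
    J(k+1,q+1) (resolves_cone).  All its generators in homological degree i
    have degree q+1+i, so its differentials have linear entries, and it is
    minimal for that reason alone (linear_minimal).  Its ranks obey the
    recursion satisfied by binom(k,q+i) binom(q+i-1,i) (linear_bettiS).

    Uniqueness.  For two minimal graded free resolutions F and G of one ideal,
    the identity lifts to graded chain maps in both directions (comparison).
    The composite on F is homotopic to the identity, and minimality makes the
    homotopy terms vanish modulo the variables (minimal_chain_endo).  So the
    matrices of constant terms are mutually inverse, and being graded they
    connect only basis vectors of equal degrees (minimal_resolution_iso).
    Therefore F has the same ranks as the linear resolution above, and the
    same degrees (betti_of_linear). *)

(** * Homogeneous components and graded matrices *)

Section GradedMatrices.

Import GRing.Theory.
Local Open Scope ring_scope.

Variables (K : fieldType) (n : nat).
Local Notation S := {mpoly K[n]}.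

Lemma homogeneousP (d : int) (f : S) :
  homogeneous_of_degree d f <-> forall m, (mdeg m)%:Z != d -> f@_m = 0.
Proof.
split=> [hf m | hf m].
  by move=> /eqP md; apply/eqP; rewrite mcoeff_eq0; apply/negP => /hf.
by rewrite mcoeff_msupp => fm; apply/eqP; apply/contraR: fm => /hf ->.
Qed.

Lemma homogeneousD (d : int) (f g : S) :
  homogeneous_of_degree d f -> homogeneous_of_degree d g ->
  homogeneous_of_degree d (f + g).
Proof.
by move=> /homogeneousP hf /homogeneousP hg; apply/homogeneousP => m md;
   rewrite mcoeffD hf ?hg ?addr0.
Qed.

Lemma homogeneousN (d : int) (f : S) :
  homogeneous_of_degree d f -> homogeneous_of_degree d (- f).
Proof.
by move=> /homogeneousP hf; apply/homogeneousP => m md;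
   rewrite mcoeffN hf ?oppr0.
Qed.

Lemma homogeneous0 (d : int) : homogeneous_of_degree d (0 : S).
Proof. by apply/homogeneousP => m _; rewrite mcoeff0. Qed.

Lemma homogeneous1 : homogeneous_of_degree 0 (1 : S).
Proof.
apply/homogeneousP => m; rewrite mcoeff1.
by have [->|] := eqVneq m 0%MM; rewrite ?mdeg0.
Qed.

Lemma homogeneousM (d e : int) (f g : S) :
  homogeneous_of_degree d f -> homogeneous_of_degree e g ->
  homogeneous_of_degree (d + e) (f * g).
Proof.
move=> hf hg m /msuppM_le /allpairsP [[m1 m2] /= [/hf <- /hg <- ->]].
by rewrite mdegD PoszD.
Qed.

Lemma homogeneousX (i : 'I_n) : homogeneous_of_degree 1 ('X_i : S).
Proof. by move=> m /mem_msuppXP <-; rewrite mdeg1. Qed.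

Definition hpart (d : int) (f : S) : S :=
  \sum_(m <- msupp f | (mdeg m)%:Z == d) f@_m *: 'X_[m].

Lemma mcoeff_hpart d f m :
  (hpart d f)@_m = if (mdeg m)%:Z == d then f@_m else 0.
Proof.
rewrite /hpart raddf_sum /=.
under eq_bigr => k _ do rewrite mcoeffZ mcoeffX.
case: ifP => md; last first.
  rewrite big1 // => k kd; case: eqP => [km|]; last by rewrite mulr0.
  by move: kd; rewrite km md.
have [fm | fm] := boolP (m \in msupp f); last first.
  rewrite big_seq_cond big1; first by apply/esym/eqP; rewrite mcoeff_eq0.
  move=> k /andP [kf _]; case: eqP => [km|]; last by rewrite mulr0.
  by move: kf; rewrite km (negPf fm).
rewrite big_mkcond (bigD1_seq m) ?msupp_uniq //= md eqxx mulr1.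
by rewrite big1 ?addr0 // => k /negPf ->; rewrite mulr0 if_same.
Qed.

Lemma homogeneous_hpart d f : homogeneous_of_degree d (hpart d f).
Proof. by apply/homogeneousP => m /negPf md; rewrite mcoeff_hpart md. Qed.

Lemma hpart_id d f : homogeneous_of_degree d f -> hpart d f = f.
Proof.
move=> /homogeneousP hf; apply/mpolyP => m; rewrite mcoeff_hpart.
by case: ifP => // /negbT /hf ->.
Qed.

Lemma hpart_sum d (I : finType) (F : I -> S) :
  hpart d (\sum_i F i) = \sum_i hpart d (F i).
Proof.
apply/mpolyP => m; rewrite mcoeff_hpart !(raddf_sum (mcoeff m)) /=.
under [in RHS]eq_bigr => i _ do rewrite mcoeff_hpart.
by case: ifP => // _; rewrite big1 //.
Qed.

(** Since the factor g is homogeneous, the degree of a product monomial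
    determines the degree of its f-part; for d < e both sides vanish. *)
Lemma hpartM d e f g :
  homogeneous_of_degree e g -> hpart d (f * g) = hpart (d - e) f * g.
Proof.
move=> /homogeneousP hg; apply/mpolyP => m; rewrite mcoeff_hpart !mcoeffM.
have hd (k1 k2 : 'X_{1..n}) : m = (k1 + k2)%MM ->
    (hpart (d - e) f)@_k1 * g@_k2 =
    if (mdeg m)%:Z == d then f@_k1 * g@_k2 else 0.
  move=> ->; have [ke|/hg ->] := eqVneq (mdeg k2)%:Z e; last first.
    by rewrite !mulr0 if_same.
  rewrite mcoeff_hpart mdegD PoszD -ke eq_sym subr_eq eq_sym.
  by case: ifP => _; rewrite ?mul0r.
under [in RHS]eq_bigr => k /eqP mk do rewrite (hd _ _ mk).
by case: ifP => // _; rewrite big1 //.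
Qed.

Definition homogeneous_mx p r (a : 'I_p -> int) (b : 'I_r -> int)
    (A : 'M[S]_(p, r)) :=
  forall k l, homogeneous_of_degree (a k - b l) (A k l).

Lemma homogeneous_mulmx p r s (a : 'I_p -> int) (b : 'I_r -> int)
    (c : 'I_s -> int) (A : 'M[S]_(p, r)) (B : 'M[S]_(r, s)) :
  homogeneous_mx a b A -> homogeneous_mx b c B -> homogeneous_mx a c (A *m B).
Proof.
move=> hA hB k l; rewrite mxE; elim/big_ind: _ => [||i _].
- exact: homogeneous0.
- exact: homogeneousD.
have -> : a k - c l = (a k - b i) + (b i - c l) by ring.
exact: homogeneousM.
Qed.

(** Replacing every entry of W by its component of the degree that the grading
    prescribes does not change the product, by hpartM.  So lifts along graded
    maps can always be chosen graded. *)
Lemma homogeneous_factor p r s (a : 'I_p -> int) (b : 'I_r -> int)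
    (c : 'I_s -> int) (W : 'M[S]_(p, r)) (B : 'M[S]_(r, s)) :
  homogeneous_mx b c B -> homogeneous_mx a c (W *m B) ->
  exists2 W', homogeneous_mx a b W' & W' *m B = W *m B.
Proof.
move=> hB hWB; exists (\matrix_(k, l) hpart (a k - b l) (W k l)).
  by move=> k l; rewrite mxE; apply: homogeneous_hpart.
apply/matrixP => k l; rewrite -[RHS](hpart_id (hWB k l)) !mxE hpart_sum.
apply: eq_bigr => i _; rewrite mxE (hpartM _ _ (hB i l)).
by congr (hpart _ _ * _); ring.
Qed.

(** Maps out of a free module lift when the images of the basis vectors do. *)
Lemma row_factor p r s (A : 'M[S]_(p, s)) (B : 'M[S]_(r, s)) :
  (forall k, exists w, row k A = w *m B) -> exists W, A = W *m B.
Proof.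
move=> /fin_all_exists [w wP]; exists (\matrix_k w k).
by apply/row_matrixP => k; rewrite row_mul rowK wP.
Qed.

End GradedMatrices.

(** * Uniqueness of minimal resolutions *)

Lemma dependent_choice (T : nat -> Type) (P : forall i, T i -> Prop)
    (Q : forall i, T i -> T i.+1 -> Prop) (x0 : T 0) :
  P 0 x0 -> (forall i x, P i x -> exists y, P i.+1 y /\ Q i x y) ->
  exists f : forall i, T i,
    [/\ f 0 = x0, forall i, P i (f i) & forall i, Q i (f i) (f i.+1)].
Proof.
move=> Px0 next.
pose step i (s : {x | P i x}) :=
  constructive_indefinite_description _ (next i (sval s) (proj2_sig s)).
pose f := fix f i : {x | P i x} :=
  if i is j.+1 then
    exist _ (sval (step j (f j))) (proj1 (proj2_sig (step j (f j))))
  else exist _ x0 Px0.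
exists (fun i => sval (f i)); split=> // i; first exact: proj2_sig.
exact: (proj2 (proj2_sig (step i (f i)))).
Qed.

Section Comparison.

Import GRing.Theory.
Local Open Scope ring_scope.

Variables (K : fieldType) (n : nat).
Local Notation S := {mpoly K[n]}.
Implicit Types (F G : free_sequence K n) (I J : S -> Prop).

(** The resolution augmented by S itself in position 0, so that exactness at
    F_0 and at the later F_i, and the induction steps below, become one
    statement. *)
Definition aug_rank F (i : nat) : nat :=
  if i is j.+1 then fr_rank F j else 1.

Definition aug_deg F (i : nat) : 'I_(aug_rank F i) -> int :=
  if i is j.+1 then @fr_deg K n F j else fun=> 0.

Definition aug_map F (i : nat) :
    'M[S]_(aug_rank F i.+1, aug_rank F i) :=
  if i is j.+1 then fr_diff F j else fr_aug F.

Lemma graded_aug_map F : graded F ->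
  forall i, homogeneous_mx (aug_deg (F := F) (i := i.+1))
                           (aug_deg (F := F) (i := i)) (aug_map F i).
Proof.
move=> [h0 h1] [|i] k l; last exact: h1.
by rewrite (ord1 l) subr0; apply: h0.
Qed.

Lemma aug_exact I F : resolves I F ->
  forall i p (A : 'M_(p, aug_rank F i.+1)),
    A *m aug_map F i = 0 <-> exists W, A = W *m aug_map F i.+1.
Proof.
move=> [_ h0 h1] i p A.
have exact1 (v : 'rV_(aug_rank F i.+1)) :
    v *m aug_map F i = 0 <-> exists w, v = w *m aug_map F i.+1.
  by case: i {A} v => [|i] v; [apply: h0 | apply: h1].
split=> [A0 | [W ->]].
  apply: row_factor => k; apply/exact1.
  by rewrite -row_mul A0 row0.
apply/row_matrixP => k; rewrite !row_mul row0; apply/exact1.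
by exists (row k W).
Qed.

Lemma aug_complex I F : resolves I F ->
  forall i, aug_map F i.+1 *m aug_map F i = 0.
Proof.
by move=> hF i; apply/(aug_exact hF); exists 1%:M; rewrite mul1mx.
Qed.

Lemma aug_image I F : resolves I F ->
  forall p (A : 'M_(p, 1)),
    (forall k, I (A k 0)) <-> exists W, A = W *m aug_map F 0.
Proof.
move=> [hI _ _] p A; split=> [hA | [W ->] k].
  apply: row_factor => k; have /hI [v vE] := hA k.
  by exists v; rewrite -vE; apply/rowP => j; rewrite !mxE (ord1 j) eqxx.
apply/hI; exists (row k W); apply: etrans (row_mul k W (aug_map F 0)).
by apply/rowP => j; rewrite !mxE (ord1 j) eqxx.
Qed.

Definition chain_map F G
    (phi : forall i, 'M[S]_(aug_rank F i, aug_rank G i)) :=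
  phi 0%N = 1%:M /\
  forall i, phi i.+1 *m aug_map G i = aug_map F i *m phi i.

(** The comparison theorem, starting from the identity of S in position 0.
    The induction carries the fact that the composite of the differential of
    F with phi factors through G: it holds at the start because I is
    contained in J, and afterwards because G is exact. *)
Lemma comparison I J F G :
    graded F -> graded G -> resolves I F -> resolves J G ->
    (forall f, I f -> J f) ->
  exists2 phi, chain_map (F := F) (G := G) phi &
    forall i, homogeneous_mx (aug_deg (F := F) (i := i))
                             (aug_deg (F := G) (i := i)) (phi i).
Proof.
move=> gF gG rF rG IJ.
pose P i (phi : 'M[S]_(aug_rank F i, aug_rank G i)) :=
  homogeneous_mx (aug_deg (F := F) (i := i)) (aug_deg (F := G) (i := i)) phi
  /\ exists W, aug_map F i *m phi = W *m aug_map G i.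
pose Q i phi (psi : 'M[S]_(aug_rank F i.+1, aug_rank G i.+1)) :=
  psi *m aug_map G i = aug_map F i *m phi.
have [|i phi [hphi [W WE]]|phi [phi0 hP hQ]] :=
  @dependent_choice (fun i => 'M[S]_(aug_rank F i, aug_rank G i)) P Q 1%:M.
- split=> [k l|].
    by rewrite (ord1 k) (ord1 l) mxE eqxx subr0; apply: homogeneous1.
  apply/(aug_image rG) => k; apply: IJ; move: k.
  by apply/(aug_image rF); exists 1%:M; rewrite mulmx1 mul1mx.
- have hW : homogeneous_mx (aug_deg (F := F) (i := i.+1))
             (aug_deg (F := G) (i := i)) (W *m aug_map G i).
    by rewrite -WE; apply: homogeneous_mulmx hphi; apply: graded_aug_map.
  have [W' hW' W'E] := homogeneous_factor (graded_aug_map gG (i := i)) hW.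
  exists W'; split; last by rewrite /Q W'E.
  split=> //; apply/(aug_exact rG).
  by rewrite -mulmxA W'E -WE mulmxA (aug_complex rF) mul0mx.
by exists phi => [|i]; [split | case: (hP i)].
Qed.

Local Notation ct := (map_mx (mcoeff 0%MM)).

(** Such a chi lifts the identity of I, so chi - 1 = D h + h' D for a homotopy
    (h, h').  Minimality makes the constant terms of D vanish, except perhaps
    for the augmentation; there the homotopy is 0. *)
Lemma minimal_chain_endo I F (chi : forall i, 'M[S]_(aug_rank F i)) :
  resolves I F -> minimal F -> chain_map (F := F) (G := F) chi ->
  forall i, ct (chi i) = 1%:M.
Proof.
move=> rF mF [chi0 chiE].
have ct_diff i p (A : 'M_(p, _)) : ct (A *m aug_map F i.+1) = 0.
  rewrite map_mxM [ct (aug_map _ _)](_ : _ = 0) ?mulmx0 //.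
  by apply/matrixP => k l; rewrite !mxE; apply: mF.
have homotopy i : exists h : 'M[S]_(aug_rank F i, aug_rank F i.+1),
    aug_map F i *m (chi i - 1%:M - h *m aug_map F i) = 0 /\
    ct (aug_map F i *m h) = 0 /\ ct (chi i) = 1%:M.
  elim: i => [|i [h [hE [cth _]]]].
    exists 0; rewrite chi0 mul0mx subrr subr0 !mulmx0 map_mx1.
    by rewrite raddf0.
  have /(aug_exact rF) [h' h'E] :
      (chi i.+1 - 1%:M - aug_map F i *m h) *m aug_map F i = 0.
    rewrite -[RHS]hE !mulmxBl !mulmxBr chiE mul1mx mulmx1 mulmxA.
    by [].
  exists h'; split; last split.
  - by rewrite -h'E opprB addrC subrK mulmxA (aug_complex rF) mul0mx.
  - rewrite map_mxM [ct (aug_map _ _)](_ : _ = 0) ?mul0mx //.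
    by apply/matrixP => k l; rewrite !mxE; apply: mF.
  have -> : chi i.+1 = 1%:M + (aug_map F i *m h + h' *m aug_map F i.+1).
    by rewrite -h'E [aug_map F i *m h + _]addrC subrK addrC subrK.
  by rewrite !raddfD /= cth ct_diff map_mx1 !addr0.
by move=> i; have [h [_ [_ ->]]] := homotopy i.
Qed.

Lemma chain_map_comp F G phi psi :
  chain_map (F := F) (G := G) phi -> chain_map (F := G) (G := F) psi ->
  chain_map (F := F) (G := F) (fun i => phi i *m psi i).
Proof.
move=> [phi0 phiE] [psi0 psiE]; split=> [|i]; first by rewrite phi0 psi0 mul1mx.
by rewrite -mulmxA psiE mulmxA phiE mulmxA.
Qed.

(** A nonzero constant can be homogeneous only of degree 0, which is why the
    graded matrix A respects degrees. *)
Lemma minimal_resolution_iso I F G :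
    minimal_graded_free_resolution I F -> minimal_graded_free_resolution I G ->
  forall i, exists (A : 'M[K]_(fr_rank F i, fr_rank G i)) B,
    A *m B = 1%:M /\ forall k l, A k l != 0 -> fr_deg k = fr_deg l.
Proof.
move=> [_ gF rF mF] [_ gG rG mG] i.
have [phi cphi hphi] := comparison gF gG rF rG (fun f h => h).
have [psi cpsi _] := comparison gG gF rG rF (fun f h => h).
exists (ct (phi i.+1)), (ct (psi i.+1)); split=> [|k l].
  rewrite -map_mxM.
  exact: (minimal_chain_endo rF mF (chain_map_comp cphi cpsi) i.+1).
rewrite mxE -mcoeff_msupp => /(hphi i.+1 k l).
by rewrite mdeg0 => /esym/eqP; rewrite subr_eq0 => /eqP.
Qed.

(** Every row of an invertible matrix has a nonzero entry, hence every basis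
    vector of F_i has the degree of some basis vector of G_i. *)
Lemma betti_of_linear I F G i (d : int) :
    minimal_graded_free_resolution I F -> minimal_graded_free_resolution I G ->
    (forall l : 'I_(fr_rank G i), fr_deg l = d) ->
  betti F i = fr_rank G i /\ graded_betti F i d = fr_rank G i.
Proof.
move=> hF hG dG.
have [A [B [AB degA]]] := minimal_resolution_iso hF hG i.
have [A' [B' [AB' _]]] := minimal_resolution_iso hG hF i.
have rFG : fr_rank F i = fr_rank G i.
  by apply/eqP; rewrite eqn_leq (mulmx1_min AB) (mulmx1_min AB').
split=> //; rewrite /graded_betti -[RHS]rFG -[RHS]card_ord -cardsT.
congr #|pred_of_set _|; apply/setP => k; rewrite !inE; apply/eqP.
have [l /degA -> //|A0] := pickP (fun l => A k l != 0).
have := congr1 (fun M : 'M_ _ => M k k) AB.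
rewrite !mxE eqxx big1 => [/esym/eqP|l _]; first by rewrite oner_eq0.
by rewrite (eqP (negbFE (A0 l))) mul0r.
Qed.

End Comparison.

(** * The ideals J(k,q) *)

Section SquarefreeIdeal.

Import GRing.Theory.
Local Open Scope ring_scope.

Variables (K : fieldType) (n : nat).
Local Notation S := {mpoly K[n]}.

Definition nvars (k : nat) (m : 'X_{1..n}) : nat :=
  #|[set i : 'I_n | (i < k)%N && (0 < m i)%N]|.

Definition vars_ideal (k q : nat) (f : S) : Prop :=
  forall m, m \in msupp f -> (q <= nvars k m)%N.

Lemma leq_nvarsD k m1 m2 : (nvars k m2 <= nvars k (m1 + m2)%MM)%N.
Proof.
apply/subset_leq_card/subsetP => i; rewrite !inE mnmDE => /andP [-> hi] /=.
by rewrite addn_gt0 hi orbT.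
Qed.

Lemma nvarsS (i : 'I_n) m : nvars i.+1 m = ((0 < m i) + nvars i m)%N.
Proof.
rewrite /nvars (cardsD1 i) inE ltnSn /=; congr (_ + #|pred_of_set _|)%N.
by apply/setP => j; rewrite !inE ltnS (ltn_neqAle j i) -val_eqE andbA.
Qed.

Lemma nvars_subX (i : 'I_n) m : nvars i (m - U_(i))%MM = nvars i m.
Proof.
congr #|pred_of_set _|; apply/setP => j; rewrite !inE mnmBE mnm1E.
by case: ltnP => //= ji; rewrite -val_eqE (gtn_eqF ji) subn0.
Qed.

Lemma nvars_addX (i : 'I_n) m : nvars i (m + U_(i))%MM = nvars i m.
Proof.
congr #|pred_of_set _|; apply/setP => j; rewrite !inE mnmDE mnm1E.
by case: ltnP => //= ji; rewrite -val_eqE (gtn_eqF ji) addn0.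
Qed.

Lemma vars_idealD k q f g :
  vars_ideal k q f -> vars_ideal k q g -> vars_ideal k q (f + g).
Proof.
by move=> hf hg m /msuppD_le; rewrite mem_cat => /orP [/hf | /hg].
Qed.

Lemma vars_ideal_sum k q (T : eqType) (s : seq T) (P : pred T) (F : T -> S) :
  (forall x, x \in s -> P x -> vars_ideal k q (F x)) ->
  vars_ideal k q (\sum_(x <- s | P x) F x).
Proof.
move=> h; rewrite big_seq_cond; elim/big_ind: _ => [m||x /andP []].
- by rewrite msupp0.
- exact: vars_idealD.
exact: h.
Qed.

Lemma vars_idealM k q f g : vars_ideal k q g -> vars_ideal k q (f * g).
Proof.
move=> hg m /msuppM_le /allpairsP [[m1 m2] /= [_ /hg h ->]].
exact: leq_trans h (leq_nvarsD _ _ _).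
Qed.

Lemma vars_idealX k q c m :
  (q <= nvars k m)%N -> vars_ideal k q (c *: 'X_[m]).
Proof. by move=> h m' /msuppZ_le /mem_msuppXP <-. Qed.

(** The variable of index i is not among the first i variables. *)
Lemma vars_ideal_mulX (i : 'I_n) q f :
  vars_ideal i q ('X_i * f) -> vars_ideal i q f.
Proof.
move=> h m fm; rewrite -(nvars_addX i m); apply: h.
by rewrite addmC mcoeff_msupp -commr_mpolyX mcoeffMX -mcoeff_msupp.
Qed.

(** Monomials that involve more than q of the first i variables go to f1; the
    others involve exactly q of them, hence are divisible by 'X_i. *)
Lemma vars_idealS (i : 'I_n) q f :
  vars_ideal i.+1 q.+1 f <->
  exists f1 f2,
    [/\ vars_ideal i q.+1 f1, vars_ideal i q f2 & f = f1 + 'X_i * f2].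
Proof.
split=> [hf | [f1 [f2 [h1 h2 ->]]]].
  exists (\sum_(m <- msupp f | (q < nvars i m)%N) f@_m *: 'X_[m]).
  exists (\sum_(m <- msupp f | ~~ (q < nvars i m)%N) f@_m *: 'X_[m - U_(i)]).
  split.
  - by apply: vars_ideal_sum => m _ hm; apply: vars_idealX.
  - apply: vars_ideal_sum => m /hf; rewrite nvarsS => hm _.
    by apply: vars_idealX; rewrite nvars_subX; case: (0 < m i)%N hm => /=; lia.
  rewrite {1}[f]mpolyE (bigID (fun m => q < nvars i m)%N) /=; congr (_ + _).
  rewrite mulr_sumr big_seq_cond [RHS]big_seq_cond; apply: eq_bigr => m.
  case/andP=> /hf; rewrite nvarsS => hm hq.
  rewrite -scalerAr -mpolyXD addmC submK //.
  by apply/mnm_lepP => j; rewrite mnm1E; case: eqP => //= <-; move: hm hq; lia.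
apply: vars_idealD => [m /h1|]; first by rewrite nvarsS; lia.
rewrite [f2]mpolyE mulr_sumr; apply: vars_ideal_sum => m /h2 hm _.
rewrite -scalerAr -mpolyXD; apply: vars_idealX.
by rewrite addmC nvarsS nvars_addX mnmDE mnm1E eqxx addn1 /= add1n ltnS.
Qed.

Lemma vars_ideal0l q f : vars_ideal 0 q.+1 f <-> f = 0.
Proof.
split=> [hf | -> m]; last by rewrite msupp0.
apply/mpolyP => m; rewrite mcoeff0; apply/eqP.
rewrite mcoeff_eq0; apply/negP => /hf.
by rewrite /nvars eq_card0 // => i; rewrite !inE.
Qed.

Lemma vars_ideal_le k q f : vars_ideal k q.+1 f -> vars_ideal k q f.
Proof. by move=> hf m /hf /ltnW. Qed.

Definition squarefree_part (q : nat) (m : 'X_{1..n}) : 'X_{1..n} :=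
  [multinom (i \in take q (enum [set j | (0 < m j)%N])) : nat | i < n].

Lemma squarefree_partP q m : (q <= nvars n m)%N ->
  [/\ forall i, (squarefree_part q m i <= 1)%N,
      mdeg (squarefree_part q m) = q & (squarefree_part q m <= m)%MM].
Proof.
move=> hq; set s := take q (enum [set j : 'I_n | (0 < m j)%N]).
have us : uniq s by rewrite take_uniq ?enum_uniq.
split=> [i||]; first by rewrite mnmE leq_b1.
  have -> : mdeg (squarefree_part q m) = #|s|.
    rewrite mdegE -sum1_card [RHS]big_mkcond; apply: eq_bigr => i _.
    by rewrite mnmE; case: (_ \in _).
  rewrite (card_uniqP _) // size_takel // -cardE (leq_trans hq) //.
  by apply/subset_leq_card/subsetP => i; rewrite !inE => /andP [].
apply/mnm_lepP => i; rewrite mnmE; case: (boolP (_ \in _)) => //= /mem_take.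
by rewrite mem_enum inE.
Qed.

(** A polynomial of J(n,q) is a combination of the generators because each of
    its monomials is a multiple of its squarefree part. *)
Lemma squarefree_idealE q (f : S) :
  squarefree_ideal q f <-> vars_ideal n q f.
Proof.
split=> [[s hs ->] | hf].
  apply: vars_ideal_sum => u us _; apply: vars_idealM.
  have [m [m1 mq ->]] := hs u us; rewrite -[ 'X_[_] ]scale1r.
  apply: vars_idealX; rewrite -mq mdegE /nvars -sum1dep_card.
  rewrite [leqRHS]big_mkcond /=.
  apply: leq_sum => i _; rewrite ltn_ord.
  by move: (m1 i); case: (m i) => //=; lia.
exists [seq (f@_m *: 'X_[m - squarefree_part q m], 'X_[squarefree_part q m])
       | m <- msupp f].
  move=> u /mapP [m /hf /squarefree_partP [h1 hq _] ->] /=.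
  by exists (squarefree_part q m).
rewrite big_map /= {1}[f]mpolyE big_seq [RHS]big_seq; apply: eq_bigr => m.
move=> /hf /squarefree_partP [_ _ hle].
by rewrite -scalerAl -mpolyXD submK.
Qed.

End SquarefreeIdeal.

(** * Linear resolutions by mapping cones *)

Section MappingCone.

Import GRing.Theory.
Local Open Scope ring_scope.

Variables (K : fieldType) (n : nat).
Local Notation S := {mpoly K[n]}.
Implicit Types (F G : free_sequence K n) (I J L : S -> Prop).

Definition linear_degrees (d : nat) F : Prop :=
  forall i (k : 'I_(fr_rank F i)), fr_deg k = (d + i)%:Z.

(** The entries of the differentials are linear forms. *)
Lemma linear_minimal d F : graded F -> linear_degrees d F -> minimal F.
Proof.
move=> [_ gF] dF i k l; have /homogeneousP := gF i k l; apply.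
rewrite !dF mdeg0; lia.
Qed.

Lemma resolves_eq I J F :
  (forall f, I f <-> J f) -> resolves I F -> resolves J F.
Proof. by move=> IJ [h0 h1 h2]; split=> // f; rewrite -IJ. Qed.

(** The shifted sequence F[-1], with the zero module in position 0; unlike in
    the augmented sequence, S does not occur in it. *)
Definition prev_rank F (i : nat) : nat :=
  if i is j.+1 then fr_rank F j else 0.

Definition prev_diff F (i : nat) : 'M[S]_(fr_rank F i, prev_rank F i) :=
  if i is j.+1 then fr_diff F j else 0.

Definition cone_aug F G (x : S) :
    'M[S]_(fr_rank F 0 + fr_rank G 0 + prev_rank F 0, 1) :=
  col_mx (col_mx (fr_aug F) (x *: fr_aug G)) 0.

Definition cone_diff F G (x : S)
    (phi : forall i, 'M[S]_(aug_rank F i, aug_rank G i)) (i : nat) :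
    'M[S]_(fr_rank F i.+1 + fr_rank G i.+1 + prev_rank F i.+1,
           fr_rank F i + fr_rank G i + prev_rank F i) :=
  block_mx (block_mx (fr_diff F i) 0 0 (fr_diff G i)) 0
           (row_mx x%:M (- phi i.+1)) (- prev_diff F i).

(** The mapping cone of (x, - phi) : F(-1) -> F + G(-1). *)
Definition linear_cone (d : nat) F G (x : S)
    (phi : forall i, 'M[S]_(aug_rank F i, aug_rank G i)) : free_sequence K n :=
  @FreeSequence K n
    (fun i => fr_rank F i + fr_rank G i + prev_rank F i)%N
    (fun i _ => (d + i)%:Z) (cone_aug F G x) (cone_diff x phi).

Lemma row_cone F G i (v : 'rV[S]_(fr_rank F i + fr_rank G i + prev_rank F i)) :
  exists a b c, v = row_mx (row_mx a b) c.
Proof.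
exists (lsubmx (lsubmx v)), (rsubmx (lsubmx v)), (rsubmx v).
by rewrite !hsubmxK.
Qed.

Lemma mul_cone_aug F G (x : S) (a : 'rV_(fr_rank F 0))
    (b : 'rV_(fr_rank G 0)) c :
  row_mx (row_mx a b) c *m cone_aug F G x
  = a *m aug_map F 0 + x *: (b *m aug_map G 0).
Proof. by rewrite !mul_row_col mulmx0 addr0 scalemxAr. Qed.

Lemma mul_cone_diff F G (x : S) phi i (a : 'rV_(fr_rank F i.+1))
    (b : 'rV_(fr_rank G i.+1)) (c : 'rV_(fr_rank F i)) :
  row_mx (row_mx a b) c *m cone_diff x phi i
  = row_mx (row_mx (a *m aug_map F i.+1 + x *: c)
                   (b *m aug_map G i.+1 - c *m phi i.+1))
           (- (c *m prev_diff F i)).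
Proof.
rewrite /cone_diff mul_row_block mulmx0 add0r mul_row_block mul_mx_row.
by rewrite !mulmx0 addr0 add0r add_row_mx mul_mx_scalar !mulmxN.
Qed.

(** Exactness of the cone, as a diagram chase: subtracting the image of the
    chain - c' turns a and b into cycles.  For i = 0 the vector c lies in S
    and is the image of b, which covers exactness at the bottom of the cone;
    the hypothesis on c is where the ideals themselves come in. *)
Lemma cone_exact I J F G (x : S) phi :
    resolves I F -> resolves J G -> chain_map (F := F) (G := G) phi ->
  forall i (a : 'rV_(aug_rank F i.+1)) (b : 'rV_(aug_rank G i.+1))
         (c : 'rV_(aug_rank F i)) c',
    a *m aug_map F i + x *: c = 0 -> b *m aug_map G i = c *m phi i ->
    c = c' *m aug_map F i ->
  exists a' b', a = a' *m aug_map F i.+1 - x *: c' /\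
                b = b' *m aug_map G i.+1 + c' *m phi i.+1.
Proof.
move=> rF rG [phi0 phiE] i a b c c' ac bc cE.
have /(aug_exact rF) [a' a'E] : (a + x *: c') *m aug_map F i = 0.
  by rewrite mulmxDl -scalemxAl -cE.
have /(aug_exact rG) [b' b'E] : (b - c' *m phi i.+1) *m aug_map G i = 0.
  by rewrite mulmxBl bc cE -!mulmxA phiE subrr.
by exists a', b'; rewrite -a'E -b'E addrK subrK.
Qed.

Lemma cone_complex I J F G (x : S) phi :
    resolves I F -> resolves J G -> chain_map (F := F) (G := G) phi ->
  forall i (a : 'rV_(aug_rank F i.+2)) (b : 'rV_(aug_rank G i.+2))
         (c : 'rV_(aug_rank F i.+1)),
    (a *m aug_map F i.+1 + x *: c) *m aug_map F i = x *: (c *m aug_map F i) /\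
    (b *m aug_map G i.+1 - c *m phi i.+1) *m aug_map G i
      = - (c *m aug_map F i *m phi i).
Proof.
move=> rF rG [phi0 phiE] i a b c.
rewrite mulmxDl mulmxBl -![_ *m aug_map _ i.+1 *m _]mulmxA.
rewrite (aug_complex rF) (aug_complex rG) !mulmx0 add0r sub0r -scalemxAl.
by rewrite -!mulmxA phiE.
Qed.

(** The condition on x * f makes the kernel of (f1, f2) |-> f1 + x f2 a copy
    of I, embedded by f |-> (x f, - f); F(-1) resolves this kernel. *)
Lemma resolves_cone I J L F G (x : S) phi d :
    resolves I F -> resolves J G -> chain_map (F := F) (G := G) phi ->
    x != 0 -> (forall f, I (x * f) -> I f) ->
    (forall f, L f <-> exists f1 f2, [/\ I f1, J f2 & f = f1 + x * f2]) ->
  resolves L (linear_cone d x phi).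
Proof.
move=> rF rG cphi x0 Ix Lx; have [phi0 phiE] := cphi.
have scalar0 (f : S) : (f%:M : 'M_1) 0 0 = f by rewrite mxE eqxx.
have memP H M : resolves H M -> forall A : 'M[S]_1,
    H (A 0 0) <-> exists W, A = W *m aug_map M 0.
  move=> rM A; rewrite -(aug_image rM); split=> [h k|]; last exact.
  by rewrite (ord1 k).
split=> [f|v|i v] /=.
- rewrite Lx; split=> [[f1 [f2 [If1 Jf2 ->]]] | [v]].
    have [|a aE] := (memP _ _ rF f1%:M).1; first by rewrite scalar0.
    have [|b bE] := (memP _ _ rG f2%:M).1; first by rewrite scalar0.
    exists (row_mx (row_mx a b) 0); rewrite mul_cone_aug -aE -bE.
    by rewrite scale_scalar_mx raddfD.
  have [a [b [c ->]]] := row_cone v; rewrite mul_cone_aug => fE.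
  exists ((a *m aug_map F 0) 0 0), ((b *m aug_map G 0) 0 0); split.
  + by apply/(memP _ _ rF); exists a.
  + by apply/(memP _ _ rG); exists b.
  by rewrite -[LHS]scalar0 fE !mxE.
- split=> [|[w ->]].
    have [a [b [c ->]]] := row_cone v; rewrite mul_cone_aug => abE.
    have [|c' c'E] := (memP _ _ rF (b *m aug_map G 0)).1.
      apply: Ix; have -> : x * (b *m aug_map G 0) 0 0
                           = (- a *m aug_map F 0) 0 0.
        move/eqP: abE; rewrite addrC addr_eq0 -mulNmx => /eqP/matrixP/(_ 0 0).
        by rewrite mxE.
      by apply/(memP _ _ rF); exists (- a).
    have bE0 : b *m aug_map G 0 = (b *m aug_map G 0) *m phi 0%N.
      by rewrite phi0 mulmx1.
    have [a' [b' [aE bE]]] := cone_exact (i := 0%N) rF rG cphi abE bE0 c'E.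
    exists (row_mx (row_mx a' b') (- c')).
    rewrite mul_cone_diff scalerN mulNmx opprK -aE -bE.
    by congr row_mx; rewrite [LHS]thinmx0 [RHS]thinmx0.
  have [a [b [c ->]]] := row_cone w; rewrite mul_cone_diff mul_cone_aug.
  have [-> ->] := cone_complex (i := 0%N) x rF rG cphi a b c.
  by rewrite phi0 mulmx1 scalerN subrr.
split=> [|[w ->]].
  have [a [b [c ->]]] := row_cone v; rewrite mul_cone_diff -!row_mx0.
  move=> /eq_row_mx [/eq_row_mx [aE bE] _].
  (* x is not a zero divisor, so x *: c is a cycle only if c is *)
  have c0 : c *m aug_map F i = 0.
    have := congr1 (mulmx^~ (aug_map F i)) aE.
    rewrite mulmxDl -mulmxA (aug_complex rF) mulmx0 add0r -scalemxAl mul0mx.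
    move=> xc; apply/matrixP => k l; move/matrixP/(_ k l)/eqP: xc.
    by rewrite mxE [X in _ == X]mxE mulf_eq0 (negPf x0) => /eqP ->; rewrite mxE.
  have [c' c'E] := (aug_exact rF _).1 c0.
  have bE0 : b *m aug_map G i.+1 = c *m phi i.+1.
    by apply/eqP; rewrite -subr_eq0 bE.
  have [a' [b' [-> ->]]] := cone_exact (i := i.+1) rF rG cphi aE bE0 c'E.
  exists (row_mx (row_mx a' b') (- c')).
  by rewrite mul_cone_diff scalerN !mulNmx !opprK c'E.
have [a [b [c ->]]] := row_cone w; rewrite !mul_cone_diff.
have [-> ->] := cone_complex (i := i.+1) x rF rG cphi a b c.
rewrite scalerN subrr mulNmx opprK addNr.
have prev0 : (- (c *m fr_diff F i)) *m prev_diff F i = 0.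
  case: i {v w a b} c => [|i] c; first by rewrite mulmx0.
  by rewrite mulNmx -mulmxA (aug_complex rF i.+1) mulmx0 oppr0.
by rewrite [X in row_mx _ (- X)]prev0 oppr0 !row_mx0.
Qed.

Definition entries_homogeneous p r (e : int) (A : 'M[S]_(p, r)) : Prop :=
  forall k l, homogeneous_of_degree e (A k l).

Lemma entries_homogeneous_row p r s e (A : 'M_(p, r)) (B : 'M_(p, s)) :
  entries_homogeneous e A -> entries_homogeneous e B ->
  entries_homogeneous e (row_mx A B).
Proof. by move=> hA hB k l; rewrite mxE; case: split. Qed.

Lemma entries_homogeneous_col p r s e (A : 'M_(p, r)) (B : 'M_(s, r)) :
  entries_homogeneous e A -> entries_homogeneous e B ->
  entries_homogeneous e (col_mx A B).
Proof. by move=> hA hB k l; rewrite mxE; case: split. Qed.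

Lemma entries_homogeneousN p r e (A : 'M_(p, r)) :
  entries_homogeneous e A -> entries_homogeneous e (- A).
Proof. by move=> hA k l; rewrite mxE; apply: homogeneousN. Qed.

Lemma entries_homogeneous0 p r e : entries_homogeneous e (0 : 'M_(p, r)).
Proof. by move=> k l; rewrite mxE; apply: homogeneous0. Qed.

Lemma graded_cone d F G (x : S) phi :
    graded F -> graded G -> linear_degrees d.+1 F -> linear_degrees d G ->
    homogeneous_of_degree 1 x ->
    (forall i, homogeneous_mx (aug_deg (F := F) (i := i))
                              (aug_deg (F := G) (i := i)) (phi i)) ->
  graded (linear_cone d.+1 (F := F) (G := G) x phi).
Proof.
move=> gF gG dF dG hx hphi.
have linear_diff M e (gM : graded M) (dM : linear_degrees e M) i :
    entries_homogeneous 1 (fr_diff M i).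
  move=> k l; have := gM.2 i k l; rewrite !dM.
  by have -> : (e + i.+1)%:Z - (e + i)%:Z = 1 by lia.
split=> /= [k | i k l].
  move: k (0 : 'I_1); apply: entries_homogeneous_col.
    apply: entries_homogeneous_col => k l; rewrite (ord1 l).
      by have := gF.1 k; rewrite dF.
    rewrite mxE; have := homogeneousM hx (gG.1 k); rewrite dG.
    by have -> : 1 + (d + 0)%:Z = (d.+1 + 0)%:Z by lia.
  exact: entries_homogeneous0.
have -> : (d.+1 + i.+1)%:Z - (d.+1 + i)%:Z = 1 by lia.
move: k l; apply: entries_homogeneous_col; apply: entries_homogeneous_row.
- apply: entries_homogeneous_col; apply: entries_homogeneous_row;
    by [apply: linear_diff gF dF _ | apply: linear_diff gG dG _
       | apply: entries_homogeneous0].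
- exact: entries_homogeneous0.
- apply: entries_homogeneous_row => [k l|].
    by rewrite mxE; case: eqP => _; rewrite ?mulr1n ?mulr0n //;
       apply: homogeneous0.
  apply: entries_homogeneousN => k l; have := hphi i.+1 k l.
  by rewrite /= dF dG; have -> : (d.+1 + i)%:Z - (d + i)%:Z = 1 by lia.
apply: entries_homogeneousN; case: i => [|i]; first exact: entries_homogeneous0.
exact: linear_diff gF dF _.
Qed.

Definition unit_sequence : free_sequence K n :=
  @FreeSequence K n (fun i => (i == 0)%N) (fun i _ => i%:Z) 1%:M (fun=> 0).

Lemma resolves_unit : resolves (fun=> True) unit_sequence.
Proof.
split=> [f | v | i v] /=.
- by split=> // _; exists f%:M; rewrite mulmx1.
- rewrite mulmx1; split=> [-> | [w ->]]; last by rewrite mulmx0.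
  by exists 0; rewrite mul0mx.
by split=> _; [exists 0 | ]; rewrite ?[v]thinmx0 ?mul0mx.
Qed.

Definition zero_sequence : free_sequence K n :=
  @FreeSequence K n (fun=> 0%N) (fun i _ => 0) 0 (fun=> 0).

Lemma resolves_zero : resolves (fun f => f = 0) zero_sequence.
Proof.
split=> [f | v | i v] /=.
- split=> [-> | [v /matrixP /(_ 0 0)]]; last by rewrite mulmx0 !mxE eqxx.
  by exists 0; rewrite mulmx0 raddf0.
- by split=> _; [exists 0 | ]; rewrite ?[v]thinmx0 ?mul0mx.
by split=> _; [exists 0 | ]; rewrite ?[v]thinmx0 ?mul0mx.
Qed.

(** Truncated subtraction makes the case q = 0 correct as well: it gives the
    ranks of the resolution of the unit ideal. *)
Definition linear_betti (k q i : nat) : nat :=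
  ('C(k, q + i) * 'C(q + i - 1, i))%N.

Lemma linear_betti0 k i : linear_betti k 0 i = (i == 0)%N.
Proof.
rewrite /linear_betti; case: i => [|i]; first by rewrite !bin0.
by rewrite [X in (_ * X)%N]bin_small ?muln0 //; lia.
Qed.

Lemma linear_bettiS k q i :
  linear_betti k.+1 q.+1 i =
  (linear_betti k q.+1 i + linear_betti k q i
   + (if i is j.+1 then linear_betti k q.+1 j else 0))%N.
Proof.
rewrite /linear_betti; case: i => [|i].
  by rewrite !addn0 !bin0 !muln1 binS.
rewrite !addSn !addnS !subSS !subn0 binS mulnDl -addnA -mulnDr.
by rewrite -binS.
Qed.

(** Induction on k for all q at once, starting from J(k,0) = S and
    J(0,q+1) = 0. *)
Lemma linear_resolution k q : (k <= n)%N ->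
  exists F, [/\ graded F, resolves (@vars_ideal K n k q) F, linear_degrees q F
              & forall i, fr_rank F i = linear_betti k q i].
Proof.
have unit_case j : exists F, [/\ graded F, resolves (@vars_ideal K n j 0) F,
    linear_degrees 0 F & forall i, fr_rank F i = linear_betti j 0 i].
  exists unit_sequence; split=> //.
  - split=> /= [i | i k0 l]; last by rewrite mxE; apply: homogeneous0.
    by rewrite mxE (ord1 i); apply: homogeneous1.
  - by apply: resolves_eq resolves_unit.
  by move=> i; rewrite linear_betti0.
elim: k q => [|k IH] [|q] hk; try exact: unit_case.
  exists zero_sequence; split=> //.
  - by split=> /= [[]|i []].
  - by apply: resolves_eq resolves_zero => f; rewrite vars_ideal0l.
  - by move=> i [].
have [F [gF rF dF rkF]] := IH q.+1 (ltnW hk).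
have [G [gG rG dG rkG]] := IH q (ltnW hk).
have [phi cphi hphi] := comparison gF gG rF rG (@vars_ideal_le _ _ _ _).
pose x : 'I_n := Ordinal hk.
exists (linear_cone q.+1 (F := F) (G := G) 'X_x phi); split=> //.
- by apply: graded_cone => //; apply: homogeneousX.
- apply: resolves_cone rF rG cphi _ _ _ => [|f|f].
  + by rewrite -msupp_eq0 msuppX.
  + exact: (@vars_ideal_mulX _ _ x).
  exact: (@vars_idealS _ _ x).
move=> i /=; rewrite linear_bettiS rkF rkG; congr (_ + _)%N.
by case: i => [|i] //=; rewrite rkF.
Qed.

End MappingCone.

Theorem lemma3p1 (K : fieldType) (n q : nat) (hq : 1 <= q <= n) :
  (exists F : free_sequence K n,
     minimal_graded_free_resolution (@squarefree_ideal K n q) F) /\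
  (forall F : free_sequence K n,
     minimal_graded_free_resolution (@squarefree_ideal K n q) F ->
     forall i : nat,
       betti F i = graded_betti F i (Posz (q + i)) /\
       graded_betti F i (Posz (q + i)) = 'C(n, q + i) * 'C(q + i - 1, i)).
Proof.
have [G [gG rG dG rkG]] := linear_resolution K q (leqnn n).
have hG : minimal_graded_free_resolution (@squarefree_ideal K n q) G.
  split=> //; last exact: linear_minimal dG.
    exists n => i hi; rewrite rkG /linear_betti bin_small //.
    exact: leq_trans hi (leq_addl _ _).
  by apply: resolves_eq rG => f; rewrite squarefree_idealE.
split; first by exists G.
move=> F hF i.
have [-> ->] := betti_of_linear hF hG (dG i).
by rewrite rkG.
Qed.
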